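(* Let $d\ge 2$, let $U$ be a unitary operator on $\mathbb{C}^d$, and let $\Pi=\{\Pi_1,\Pi_2\}$ be a PVM on $\mathbb{C}^d$ such that $\operatorname{rank}\Pi_1=d-1$ and $\operatorname{rank}\Pi_2=1$. Let $\mathbb{P}_*$ be the Kusuoka measure on $\{1,2\}^{\mathbb{N}}$ induced by $U$ and $\Pi$. Then $$\mathbb{P}_*(C_{(i_1,\ldots,i_n)})=\mathbb{P}_*(C_{(i_n,\ldots,i_1)})$$ for every $n\ge 1$ and every $(i_1,\ldots,i_n)\in\{1,2\}^n$.
   Context: A PVM (projection valued measure) $\{\Pi_1,\Pi_2\}$ on $\mathbb{C}^d$ is a pair of non-zero orthogonal projections (self-adjoint idempotents) with $\Pi_1+\Pi_2=\mathbb{I}$. Let $\rho_*:=\mathbb{I}/d$. The Kusuoka measure $\mathbb{P}_*$ induced by $U$ and $\Pi$ is the unique probability measure on $\{1,2\}^{\mathbb{N}}$ (with the $\sigma$-algebra generated by all cylinder sets) such that for every $n\ge 1$ and $(i_1,\ldots,i_n)\in\{1,2\}^n$, $$\mathbb{P}_*(C_{(i_1,\ldots,i_n)})=\operatorname{tr}\left(\Pi_{i_n}U\cdots\Pi_{i_1}U\rho_*U^*\Pi_{i_1}\cdots U^*\Pi_{i_n}\right),$$ where $C_{(i_1,\ldots,i_n)}:=\{(s_j)_{j=1}^\infty\in\{1,2\}^{\mathbb{N}} : s_1=i_1,\ldots,s_n=i_n\}$ is the cylinder set of the string $(i_1,\ldots,i_n)$. *)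

(* Defs.v *)
(* MathComp-Analysis, with [complex R = R[i]] (real-closed) as the field of
   complex numbers. *)
From HB Require Import structures.
From mathcomp Require Import all_boot all_order all_algebra.
From mathcomp Require Import sesquilinear spectral.
From mathcomp Require Import all_classical all_reals all_analysis.
From mathcomp Require Import complex.
Set Implicit Arguments.
Unset Strict Implicit.
Unset Printing Implicit Defensive.
Import Order.TTheory GRing.Theory Num.Theory.
Local Open Scope classical_set_scope.
Local Open Scope ring_scope.
Local Open Scope sesquilinear_scope.
Local Open Scope complex_scope.

(* needed by [g_sigma_algebraType] below *)
HB.instance Definition _ := isPointed.Build 'I_2 ord0.

(* The outcomes 1 and 2 are encoded as the elements 0 and 1 of 'I_2. *)
Definition outcome1 : 'I_2 := ord0.
Definition outcome2 : 'I_2 := ord_max.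

(* Operators on C^d are d x d complex matrices; the adjoint of A is A ^t*, and
   [A \is hermsymmx] says A = A ^t*. *)
Definition orthogonal_projection (R : realType) (d : nat) (P : 'M[R[i]]_d) :=
  P \is hermsymmx /\ P *m P = P.

Definition is_PVM (R : realType) (d : nat) (Pi : 'I_2 -> 'M[R[i]]_d) :=
  [/\ forall i, orthogonal_projection (Pi i),
      forall i, Pi i != 0
    & Pi outcome1 + Pi outcome2 = 1%:M].

Definition maximally_mixed (R : realType) (d : nat) : 'M[R[i]]_d :=
  d%:R^-1 *: 1%:M.

(* Pi_{i_n} U ... Pi_{i_1} U rho U^* Pi_{i_1} ... U^* Pi_{i_n} *)
Definition evolve (R : realType) (d : nat) (U : 'M[R[i]]_d)
    (Pi : 'I_2 -> 'M[R[i]]_d) (w : seq 'I_2) (rho : 'M[R[i]]_d) : 'M[R[i]]_d :=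
  foldl (fun sigma i => Pi i *m U *m sigma *m U ^t* *m Pi i) rho w.

(* Sequences are indexed from 0: the j-th term is s (j - 1). *)
Definition cylinder (n : nat) (w : n.-tuple 'I_2) : set (nat -> 'I_2) :=
  [set s | forall j : 'I_n, s j = tnth w j].

Definition cylinders : set (set (nat -> 'I_2)) :=
  [set A | exists n, exists w : n.-tuple 'I_2, (0 < n)%N /\ A = cylinder w].

(* {1,2}^N with the sigma-algebra generated by the cylinder sets *)
Definition outcome_sequences : measurableType cylinders.-sigma :=
  g_sigma_algebraType cylinders.

(* Characterizing property of the Kusuoka measure. Cylinders generate the
   sigma-algebra and, with the empty set, form a pi-system, so at most one
   probability satisfies it. Equality is in R[i], hence includes that the trace
   is real. *)
Definition is_Kusuoka_measure (R : realType) (d : nat) (U : 'M[R[i]]_d)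
    (Pi : 'I_2 -> 'M[R[i]]_d) (P : probability outcome_sequences R) :=
  forall (n : nat) (w : n.-tuple 'I_2), (0 < n)%N ->
    (fine (P (cylinder w)))%:C = \tr (evolve U Pi w (maximally_mixed R d)).

(* Main.v *)
Require Import Defs.
From HB Require Import structures.
From mathcomp Require Import all_boot all_order all_algebra.
From mathcomp Require Import sesquilinear spectral.
From mathcomp Require Import all_classical all_reals all_analysis.
From mathcomp Require Import complex.
Import Order.TTheory GRing.Theory Num.Theory.
Local Open Scope ring_scope.
Local Open Scope sesquilinear_scope.
Local Open Scope complex_scope.

(** Write [1] and [2] for the outcomes and [p w] for the trace that gives the
    measure of the cylinder of the word [w].  Three facts about [p] suffice.

    Summing [p] over the last letter of a word forgets that letter, because the
    evolution followed by the sum over outcomes preserves the trace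
    ([trace_evolve_last]).  Summing over the first letter forgets that letter,
    because the same map fixes the maximally mixed state
    ([trace_evolve_first]).  Finally, as [Pi_2] has rank one, every occurrence
    of the outcome [2] resets the system to the state [Pi_2], whatever happened
    before; so [p] factors there: [p (u2v) = d p (u2) p (2v)]
    ([trace_evolve_renewal]).

    Any function of words with these properties is invariant under reversal
    ([renewal_rev]).  Factoring at each [2] leaves words [2 1^a 2], which are
    palindromes, and the two end pieces [1^a 2] and [2 1^b].  For those, both
    marginal identities give
    [p (1^a 2) = p (1^a) - p (1^(a+1)) = p (2 1^a)]. *)

Lemma outcome_dichotomy (i : 'I_2) : i = outcome1 \/ i = outcome2.
Proof. by case: i => [[|[|//]] hi]; [left|right]; apply/val_inj. Qed.

Lemma rcons_nseq (T : Type) a (x : T) : rcons (nseq a x) x = nseq a.+1 x.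
Proof. by rewrite -cats1 -(nseqD a 1) addn1. Qed.

Lemma split_last_outcome2 (u : seq 'I_2) :
  (exists a, u = nseq a outcome1) \/
  (exists s a, u = s ++ outcome2 :: nseq a outcome1).
Proof.
elim/last_ind: u => [|u i IHu]; first by left; exists 0%N.
case: (outcome_dichotomy i) => ->; last first.
  by right; exists u, 0%N; rewrite -cats1.
case: IHu => [[a ->]|[s [a ->]]].
  by left; exists a.+1; rewrite rcons_nseq.
by right; exists s, a.+1; rewrite rcons_cat rcons_cons rcons_nseq.
Qed.

Section Renewal.

Variables (F : comPzRingType) (c : F) (p : seq 'I_2 -> F).
Hypothesis sum_first : forall w, p (outcome1 :: w) + p (outcome2 :: w) = p w.
Hypothesis sum_last :
  forall w, p (rcons w outcome1) + p (rcons w outcome2) = p w.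
Hypothesis renewal : forall u v,
  p (u ++ outcome2 :: v) = c * p (rcons u outcome2) * p (outcome2 :: v).

(** Both sides are [p (1^a) - p (1^(a+1))]: remove the letter [2] by summing
    over it, on the right for one and on the left for the other. *)
Lemma renewal_rev_run a :
  p (rcons (nseq a outcome1) outcome2) = p (outcome2 :: nseq a outcome1).
Proof.
apply: (@addrI _ (p (outcome1 :: nseq a outcome1))).
rewrite sum_first -[X in p X + _]/(nseq a.+1 outcome1).
by rewrite -[nseq a.+1 _]rcons_nseq sum_last.
Qed.

(** Cut [u] at its last [2]: the factor [2 1^a 2] that splits off is a
    palindrome, and what remains is shorter. *)
Lemma renewal_rev_rcons u : p (rcons u outcome2) = p (outcome2 :: rev u).
Proof.
have [n] := ubnP (size u); elim: n u => // n IHn u.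
case: (split_last_outcome2 u) => [[a ->] _|[s [a ->]]].
  by rewrite rev_nseq renewal_rev_run.
rewrite size_cat /= size_nseq addnS ltnS => hsize.
rewrite rcons_cat rcons_cons renewal IHn; last first.
  exact: leq_ltn_trans (leq_addr a _) hsize.
rewrite rev_cat rev_cons rev_nseq cat_rcons -cat_cons renewal rcons_cons.
by rewrite mulrAC.
Qed.

(** Cut [w] at its last [2] and reverse the two pieces separately. *)
Lemma renewal_rev w : p (rev w) = p w.
Proof.
case: (split_last_outcome2 w) => [[a ->]|[s [a ->]]]; first by rewrite rev_nseq.
rewrite rev_cat rev_cons rev_nseq cat_rcons !renewal.
by rewrite renewal_rev_run renewal_rev_rcons mulrAC.
Qed.

End Renewal.

(** Write [P = x *m y] with [x] a column and [y] a row.  Then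
    [P A P = x (y A x) y] is a multiple of [P], and the factor is a trace
    because [P = P P] forces [y x = 1], that is [\tr P = 1]. *)
Lemma mulmx_rank1_idempotent (F : fieldType) (n : nat) (P A : 'M[F]_n) :
  \rank P = 1%N -> P *m P = P -> P *m A *m P = \tr (P *m A *m P) *: P.
Proof.
move=> rP PP; have := mulmx_base P.
move: (col_base P) (row_base P); rewrite rP => x y Pxy.
have P0 : P != 0 by rewrite -mxrank_eq0 rP.
have sandwich B : P *m B *m P = (y *m B *m x) 0 0 *: P.
  rewrite -{1 2}Pxy !mulmxA -2!(mulmxA x).
  by rewrite {1}[y *m B *m x]mx11_scalar mul_mx_scalar -scalemxAl Pxy.
have trP : \tr P = 1.
  have := sandwich 1%:M; rewrite !mulmx1 PP -{1}[P]scale1r.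
  move/eqP; rewrite -subr_eq0 -scalerBl scaler_eq0 (negPf P0) orbF subr_eq0.
  by rewrite -Pxy mxtrace_mulC /mxtrace big_ord1 => /eqP <-.
by rewrite sandwich mxtraceZ trP mulr1.
Qed.

Section Evolution.

Variables (R : realType) (d : nat) (U : 'M[R[i]]_d) (Pi : 'I_2 -> 'M[R[i]]_d).
Hypotheses (unitaryU : U \is unitarymx) (PVM_Pi : is_PVM Pi).

Local Notation rho_star := (maximally_mixed R d).
Local Notation p w := (\tr (evolve U Pi w rho_star)).

Let PiPi i : Pi i *m Pi i = Pi i.
Proof. by case: PVM_Pi => /(_ i) [_]. Qed.

Let sum_Pi : Pi outcome1 + Pi outcome2 = 1%:M.
Proof. by case: PVM_Pi. Qed.

Let UUstar : U *m U ^t* = 1%:M.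
Proof. exact/unitarymxP. Qed.

Lemma evolveD w rho sigma :
  evolve U Pi w (rho + sigma) = evolve U Pi w rho + evolve U Pi w sigma.
Proof.
elim: w rho sigma => //= i w IHw rho sigma.
by rewrite mulmxDr !mulmxDl IHw.
Qed.

Lemma evolveZ w k rho :
  evolve U Pi w (k *: rho) = k *: evolve U Pi w rho.
Proof.
elim: w rho => //= i w IHw rho.
by rewrite -scalemxAr -!scalemxAl IHw.
Qed.

Lemma evolve_cat u v rho :
  evolve U Pi (u ++ v) rho = evolve U Pi v (evolve U Pi u rho).
Proof. exact: foldl_cat. Qed.

Lemma evolve_letter_mixed i : evolve U Pi [:: i] rho_star = d%:R^-1 *: Pi i.
Proof.
rewrite /evolve /= /maximally_mixed -scalemxAr mulmx1 -!scalemxAl.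
by rewrite -[Pi i *m U *m _]mulmxA UUstar mulmx1 PiPi.
Qed.

Lemma trace_evolve_letter i rho :
  \tr (evolve U Pi [:: i] rho) = \tr (Pi i *m (U *m rho *m U ^t*)).
Proof. by rewrite /evolve /= mxtrace_mulC !mulmxA PiPi. Qed.

Lemma trace_evolve_first w : p (outcome1 :: w) + p (outcome2 :: w) = p w.
Proof.
rewrite -(cat1s outcome1) -(cat1s outcome2) !evolve_cat -mxtraceD -evolveD.
by rewrite !evolve_letter_mixed -scalerDr sum_Pi.
Qed.

Lemma trace_evolve_last w :
  p (rcons w outcome1) + p (rcons w outcome2) = p w.
Proof.
rewrite -!cats1 !evolve_cat !trace_evolve_letter -mxtraceD -mulmxDl sum_Pi.
by rewrite mul1mx mxtrace_mulC mulmxA (mulmx1C UUstar) mul1mx.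
Qed.

(** A [2] leaves the multiple of [Pi_2] with the right trace, by
    [mulmx_rank1_idempotent].  A word that starts with [2] is in the same
    state after that letter, with the trace [d^-1]; hence the factor [d]. *)
Lemma trace_evolve_renewal u v :
  (0 < d)%N -> \rank (Pi outcome2) = 1%N ->
  p (u ++ outcome2 :: v) = d%:R * p (rcons u outcome2) * p (outcome2 :: v).
Proof.
move=> d_gt0 rk2.
have d0 : d%:R != 0 :> R[i] by rewrite pnatr_eq0 -lt0n.
rewrite -cat_rcons evolve_cat -[outcome2 :: v]cat1s [in RHS]evolve_cat.
set sigma := evolve U Pi (rcons u outcome2) _.
rewrite evolve_letter_mixed evolveZ mxtraceZ.
have {1}-> : sigma = \tr sigma *: Pi outcome2.
  rewrite /sigma -cats1 evolve_cat /evolve /= -!(mulmxA (Pi outcome2)).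
  by rewrite mulmxA; apply: mulmx_rank1_idempotent.
by rewrite evolveZ mxtraceZ mulrACA divff // mul1r.
Qed.

End Evolution.

Lemma measurable_cylinder (n : nat) (w : n.-tuple 'I_2) :
  (0 < n)%N -> measurable (cylinder w : set outcome_sequences).
Proof. by move=> n_gt0; apply: sub_gen_smallest; exists n, w. Qed.

Theorem theorem15 (R : realType) (d : nat) (U : 'M[R[i]]_d)
    (Pi : 'I_2 -> 'M[R[i]]_d) (Pstar : probability outcome_sequences R)
    (hd : (2 <= d)%N) (hU : U \is unitarymx) (hPi : is_PVM Pi)
    (hrank1 : \rank (Pi outcome1) = (d - 1)%N)
    (hrank2 : \rank (Pi outcome2) = 1%N)
    (hP : is_Kusuoka_measure U Pi Pstar)
    (n : nat) (hn : (1 <= n)%N) (w : n.-tuple 'I_2) :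
  Pstar (cylinder w) = Pstar (cylinder (rev_tuple w)).
Proof.
have finP (v : n.-tuple 'I_2) : Pstar (cylinder v) \is a fin_num.
  by apply: fin_num_measure; apply: measurable_cylinder.
rewrite -[LHS]fineK // -[RHS]fineK //; congr (_%:E); apply: complexI.
rewrite !hP // [val (rev_tuple w)]/=; apply/esym.
apply: (@renewal_rev _ d%:R (fun v => \tr (evolve U Pi v _))).
- exact: trace_evolve_first.
- exact: trace_evolve_last.
- by move=> u v; apply: trace_evolve_renewal => //; apply: ltnW.
Qed.
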